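(* Let $A$ be an algebra over a field $K$ of characteristic zero, let $\delta_1,\ldots,\delta_s$ be commuting locally nilpotent $K$-derivations of $A$, and let $x_1,\ldots,x_s\in A$ satisfy $\delta_i(x_j)=\delta_{ij}$ (the Kronecker delta) for all $i,j$. Let $\mathfrak m$ be a (two-sided) maximal ideal of the algebra $A^\delta=\bigcap_{i=1}^s\ker\delta_i$ such that $[x_i,\mathfrak m]\subseteq\mathfrak m$ and $[x_i,Z]\subseteq\mathfrak m$ for all $i=1,\ldots,s$, where $Z$ is the centre of the factor algebra $A^\delta/\mathfrak m$. Then the iterated Ore extension $\mathcal A:=A/(\mathfrak m)[t_1,\ldots,t_s;\delta_1,\ldots,\delta_s]$ of the algebra $A/(\mathfrak m)$ is a simple algebra, where $(\mathfrak m):=A\mathfrak mA$, the elements $t_1,\ldots,t_s$ commute, and $t_ia=at_i+\delta_i(a)$ for all $a\in A/(\mathfrak m)$, where $\delta_i\in\mathrm{Der}_K(A/(\mathfrak m))$ is the induced derivation $u+(\mathfrak m)\mapsto\delta_i(u)+(\mathfrak m)$, $u\in A$.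
   Context: Algebras are associative and unital, not necessarily commutative; $[a,b]=ab-ba$. A derivation is locally nilpotent if each element is killed by some power of it. In this setting $[x_i,A^\delta]\subseteq A^\delta$, so when $[x_i,\mathfrak m]\subseteq\mathfrak m$ the map $\mathrm{ad}(x_i)=[x_i,\cdot]$ induces a derivation of $A^\delta/\mathfrak m$; the condition $[x_i,Z]\subseteq\mathfrak m$ means that this induced derivation vanishes on $Z$. As a left $A/(\mathfrak m)$-module, $\mathcal A$ is free on the monomials $t_1^{\alpha_1}\cdots t_s^{\alpha_s}$, $\alpha\in\mathbb N^s$. *)

(* Defs.v *)
From HB Require Import structures.
From mathcomp Require Import all_boot all_algebra.
From mathcomp Require Import finmap boolp classical_sets monalg.

Set Implicit Arguments.
Unset Strict Implicit.
Unset Printing Implicit Defensive.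

Import GRing.Theory.
Local Open Scope ring_scope.
Local Open Scope classical_set_scope.
Local Open Scope quotient_scope.

Definition lie (R : pzRingType) (a b : R) : R := a * b - b * a.

Definition center (R : pzRingType) : set R :=
  [set z | forall a, z * a = a * z].

(* Two-sided ideals.  In a unital algebra over K, where c *: a = c%:A * a, the
   ring ideals are exactly the algebra ideals, so scalars are not mentioned.
   Rings are `pzRingType`s throughout because the quotient by an ideal that is
   not known to be proper may be the zero ring. *)
Record ideal (R : pzRingType) := Ideal {
  ideal_set :> R -> Prop;
  ideal0 : ideal_set 0;
  idealD : forall a b, ideal_set a -> ideal_set b -> ideal_set (a + b);
  idealMl : forall a b, ideal_set b -> ideal_set (a * b);
  idealMr : forall a b, ideal_set a -> ideal_set (a * b)
}.

Definition maximal_ideal (R : pzRingType) (M : ideal R) : Prop :=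
  ideal_set M <> setT /\
  forall J : ideal R, ideal_set M `<=` J ->
    ideal_set J = M \/ ideal_set J = setT.

Definition simple_ring (R : pzRingType) : Prop :=
  (1 : R) <> 0 /\
  forall J : ideal R, ideal_set J = [set 0] \/ ideal_set J = setT.

Section GeneratedIdeal.
Variables (R : pzRingType) (S : set R).

Definition gen_set : set R := [set u | exists n (a y b : 'I_n -> R),
  (forall k, S (y k)) /\ u = \sum_(k < n) a k * y k * b k].

Lemma gen_set0 : gen_set 0.
Proof.
exists 0%N, (fun=> 0), (fun=> 0), (fun=> 0).
by split=> [[]//|]; rewrite big_ord0.
Qed.

Lemma gen_setD u v : gen_set u -> gen_set v -> gen_set (u + v).
Proof.
move=> [n [a [y [b [Sy ->]]]]] [n' [a' [y' [b' [Sy' ->]]]]].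
pose f T (g : 'I_n -> T) (h : 'I_n' -> T) k :=
  match split k with inl i => g i | inr j => h j end.
exists (n + n')%N, (f _ a a'), (f _ y y'), (f _ b b'); split.
  by move=> k; rewrite /f; case: (split k).
rewrite big_split_ord /f /=; congr (_ + _); apply: eq_bigr => i _.
  by have /= -> := unsplitK (inl i : 'I_n + 'I_n').
by have /= -> := unsplitK (inr i : 'I_n + 'I_n').
Qed.

Lemma gen_setMl c u : gen_set u -> gen_set (c * u).
Proof.
move=> [n [a [y [b [Sy ->]]]]]; exists n, (fun k => c * a k), y, b.
by split=> //; rewrite mulr_sumr; apply: eq_bigr => k _; rewrite !mulrA.
Qed.

Lemma gen_setMr u c : gen_set u -> gen_set (u * c).
Proof.
move=> [n [a [y [b [Sy ->]]]]]; exists n, a, y, (fun k => b k * c).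
by split=> //; rewrite mulr_suml; apply: eq_bigr => k _; rewrite !mulrA.
Qed.

Definition gen_ideal : ideal R := Ideal gen_set0 gen_setD gen_setMl gen_setMr.

End GeneratedIdeal.

Section QuotientRing.
Variables (R : pzRingType) (I : ideal R).

Definition ideal_pred : {pred R} := fun a => `[< I a >].

Lemma idealP a : reflect (I a) (a \in ideal_pred).
Proof. exact: asboolP. Qed.

Lemma ideal_zmod_closed : zmod_closed ideal_pred.
Proof.
split=> [|a b /idealP Ia /idealP Ib]; apply/idealP; first exact: ideal0.
by apply: idealD => //; rewrite -mulN1r; apply: idealMl.
Qed.

HB.instance Definition _ :=
  GRing.isZmodClosed.Build R ideal_pred ideal_zmod_closed.

Definition quot_ring : Type := Quotient.quot ideal_pred.

HB.instance Definition _ := GRing.Zmodule.on quot_ring.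

Definition quot_pi (a : R) : quot_ring := \pi_(Quotient.quot ideal_pred) a.

Lemma quot_pi_eq a b : quot_pi a = quot_pi b <-> I (a - b).
Proof.
split=> [/eqP|Iab]; last apply/eqP.
  by rewrite /quot_pi -Quotient.idealrBE => /idealP.
by rewrite /quot_pi -Quotient.idealrBE; apply/idealP.
Qed.

Lemma quot_pi_surj (u : quot_ring) : exists a, u = quot_pi a.
Proof. by exists (repr (u : Quotient.quot ideal_pred)); rewrite /quot_pi reprK. Qed.

Lemma quot_piD a b : quot_pi (a + b) = quot_pi a + quot_pi b.
Proof. by rewrite /quot_pi raddfD. Qed.

Definition quot_repr (u : quot_ring) : R :=
  repr (u : Quotient.quot ideal_pred).

Lemma quot_reprK u : quot_pi (quot_repr u) = u.
Proof. exact: reprK. Qed.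

Definition quot_mul (u v : quot_ring) := quot_pi (quot_repr u * quot_repr v).

Lemma quot_mulE a b : quot_mul (quot_pi a) (quot_pi b) = quot_pi (a * b).
Proof.
apply/quot_pi_eq; set a' := quot_repr _; set b' := quot_repr _.
have Ia : I (a' - a) by apply/quot_pi_eq; rewrite quot_reprK.
have Ib : I (b' - b) by apply/quot_pi_eq; rewrite quot_reprK.
have -> : a' * b' - a * b = (a' - a) * b' + a * (b' - b).
  by rewrite mulrBl mulrBr addrA subrK.
by apply: idealD; [apply: idealMr | apply: idealMl].
Qed.

Fact quot_mulA : associative quot_mul.
Proof.
move=> u v w; rewrite -[u]quot_reprK -[v]quot_reprK -[w]quot_reprK.
by rewrite !quot_mulE mulrA.
Qed.

Fact quot_mul1l : left_id (quot_pi 1) quot_mul.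
Proof. by move=> u; rewrite -[u]quot_reprK quot_mulE mul1r. Qed.

Fact quot_mul1r : right_id (quot_pi 1) quot_mul.
Proof. by move=> u; rewrite -[u]quot_reprK quot_mulE mulr1. Qed.

Fact quot_mulDl : left_distributive quot_mul +%R.
Proof.
move=> u v w; rewrite -[u]quot_reprK -[v]quot_reprK -[w]quot_reprK.
by rewrite -quot_piD !quot_mulE mulrDl quot_piD.
Qed.

Fact quot_mulDr : right_distributive quot_mul +%R.
Proof.
move=> u v w; rewrite -[u]quot_reprK -[v]quot_reprK -[w]quot_reprK.
by rewrite -quot_piD !quot_mulE mulrDr quot_piD.
Qed.

HB.instance Definition _ := GRing.Zmodule_isPzRing.Build quot_ring
  quot_mulA quot_mul1l quot_mul1r quot_mulDl quot_mulDr.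

Lemma quot_piM a b : quot_pi (a * b) = quot_pi a * quot_pi b.
Proof. by rewrite -quot_mulE. Qed.

Lemma quot_pi1 : quot_pi 1 = 1. Proof. by []. Qed.

End QuotientRing.

Record comm_ders (B : pzRingType) (s : nat) := CommDers {
  der :> 'I_s -> B -> B;
  derD : forall i a b, der i (a + b) = der i a + der i b;
  derM : forall i a b, der i (a * b) = der i a * b + a * der i b;
  derC : forall i j a, der i (der j a) = der j (der i a)
}.

Section Derivations.
Variables (B : pzRingType) (s : nat) (D : comm_ders B s).

Lemma der0 i : D i 0 = 0.
Proof. by apply: (addIr (D i 0)); rewrite -derD !add0r. Qed.

Lemma derN i a : D i (- a) = - D i a.
Proof. by apply/eqP; rewrite -addr_eq0 -derD addNr der0. Qed.

Lemma der1 i : D i 1 = 0.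
Proof. by apply: (addIr (D i 1)); rewrite -{3}[1]mulr1 derM mulr1 mul1r add0r. Qed.

Definition locally_nilpotent (d : B -> B) : Prop :=
  forall a, exists n, iter n d a = 0.

Definition const_pred : {pred B} := fun a => [forall i, D i a == 0].

Lemma constP a : reflect (forall i, D i a = 0) (a \in const_pred).
Proof. exact: 'forall_eqP. Qed.

Lemma const_subring_closed : subring_closed const_pred.
Proof.
split=> [|a b /constP Da /constP Db|a b /constP Da /constP Db]; apply/constP=> i.
- exact: der1.
- by rewrite derD derN Da Db subrr.
- by rewrite derM Da Db mul0r mulr0 addr0.
Qed.

Definition constants : Type := {a : B | a \in const_pred}.

HB.instance Definition _ := SubChoice.on constants.
HB.instance Definition _ := 
  GRing.SubChoice_isSubPzRing.Build B const_pred constants const_subring_closed.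

Lemma der_val i (y : constants) : D i (val y) = 0.
Proof. by have /constP := valP y. Qed.

Section Induced.
Variables (I : ideal B) (DI : forall i a, I a -> I (D i a)).

Definition quot_der i (u : quot_ring I) : quot_ring I :=
  quot_pi I (D i (quot_repr u)).

Lemma quot_derE i a : quot_der i (quot_pi I a) = quot_pi I (D i a).
Proof.
apply/quot_pi_eq; rewrite -derN -derD; apply: DI.
by apply/quot_pi_eq; rewrite quot_reprK.
Qed.

Fact quot_derD i u v : quot_der i (u + v) = quot_der i u + quot_der i v.
Proof.
rewrite -[u]quot_reprK -[v]quot_reprK.
by rewrite -quot_piD !quot_derE derD quot_piD.
Qed.

Fact quot_derM i u v : quot_der i (u * v) = quot_der i u * v + u * quot_der i v.
Proof.
rewrite -[u]quot_reprK -[v]quot_reprK.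
by rewrite -quot_piM !quot_derE derM quot_piD !quot_piM.
Qed.

Fact quot_derC i j u : quot_der i (quot_der j u) = quot_der j (quot_der i u).
Proof. by rewrite -[u]quot_reprK !quot_derE derC. Qed.

Definition quot_ders : comm_ders (quot_ring I) s :=
  CommDers quot_derD quot_derM quot_derC.

End Induced.

Section ExtendedIdeal.
Variable m : ideal constants.

(* The ideal B m B of B, m being an ideal of the subring of constants. *)
Definition ext_ideal : ideal B := gen_ideal (val @` ideal_set m).

Lemma ext_ideal_stable i a : ext_ideal a -> ext_ideal (D i a).
Proof.
move=> [n [c [y [b [my ->]]]]].
rewrite (big_morph (D i) (@derD _ _ D i) (der0 i)).
apply: (big_ind ext_ideal); first exact: ideal0.
  by move=> u v; apply: idealD.
move=> k _.
have [z mz yz] := my k.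
have Ey : ext_ideal (y k).
  exists 1%N, (fun=> 1), (fun=> y k), (fun=> 1); split=> //.
  by rewrite big_ord1 mul1r mulr1.
have D0 : D i (y k) = 0 by rewrite -yz der_val.
rewrite !derM D0 mulr0 addr0.
by apply: idealD; apply: idealMr; apply: idealMl.
Qed.

Definition ext_quot : pzRingType := quot_ring ext_ideal.

Definition ext_quot_ders : comm_ders ext_quot s := quot_ders ext_ideal_stable.

Lemma ext_quot_dersE i a :
  ext_quot_ders i (quot_pi ext_ideal a) = quot_pi ext_ideal (D i a).
Proof. exact: (quot_derE ext_ideal_stable). Qed.

End ExtendedIdeal.

End Derivations.

Section AdditiveExtension.
Variables (K : choiceType) (G V : zmodType) (h : K -> G -> V).
Hypothesis hD : forall k x y, h k (x + y) = h k x + h k y.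

Definition malg_lift (f : {malg G[K]}) : V := \sum_(k <- msupp f) h k f@_k.

Let h0 k : h k 0 = 0.
Proof. by apply: (addIr (h k 0)); rewrite -hD !add0r. Qed.

Lemma malg_liftEw (d : {fset K}) f :
  (msupp f `<=` d)%fset -> malg_lift f = \sum_(k <- d) h k f@_k.
Proof.
move=> sfd; rewrite /malg_lift (big_fset_incl _ sfd) //= => k _ kf.
by rewrite mcoeff_outdom // h0.
Qed.

Lemma malg_liftD f g : malg_lift (f + g) = malg_lift f + malg_lift g.
Proof.
pose d := (msupp f `|` msupp g)%fset.
rewrite (@malg_liftEw d (f + g)) ?msuppD_le //.
rewrite (@malg_liftEw d f) ?fsubsetUl // (@malg_liftEw d g) ?fsubsetUr //.
by rewrite -big_split; apply: eq_bigr => k _; rewrite mcoeffD hD.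
Qed.

Lemma malg_liftU x k : malg_lift << x *g k >> = h k x.
Proof.
by rewrite (malg_liftEw msuppU_le) big_seq_fset1 mcoeffUU.
Qed.

Lemma malg_lift0 : malg_lift 0 = 0.
Proof. by rewrite /malg_lift msupp0 big_seq_fset0. Qed.

End AdditiveExtension.

Lemma malg_ext (K : choiceType) (G V : zmodType) (F F' : {malg G[K]} -> V) :
  {morph F : f g / f + g} -> {morph F' : f g / f + g} ->
  (forall x k, F << x *g k >> = F' << x *g k >>) -> F =1 F'.
Proof.
move=> FD F'D FU f.
have F0 : F 0 = 0 by apply: (addIr (F 0)); rewrite -FD !add0r.
have F'0 : F' 0 = 0 by apply: (addIr (F' 0)); rewrite -F'D !add0r.
by rewrite [f]monalgE (big_morph F FD F0) (big_morph F' F'D F'0); apply: eq_bigr.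
Qed.

(* The Ore extension B[t_1, ..., t_s; D_1, ..., D_s]: the free left B-module on
   the monomials t^al = t_1^(al 1) ... t_s^(al s), whose element sum_al b_al t^al
   is stored as the finitely supported function al |-> b_al.  The product is
   (sum_al b_al t^al) g = sum_al b_al (t_1^(al 1) (... (t_s^(al s) g))), where
   t_i acts on the left by t_i (b t^al) = b t^(al + e_i) + D_i(b) t^al. *)
Definition ore (B : pzRingType) (s : nat) (D : comm_ders B s) : Type :=
  {malg B['X_{1..s}]}.

HB.instance Definition _ (B : pzRingType) (s : nat) (D : comm_ders B s) :=
  GRing.Zmodule.on (ore D).

HB.lock Definition ore_mon (B : pzRingType) (s : nat) (D : comm_ders B s)
  (b : B) (al : 'X_{1..s}) : ore D := << b *g al >>.

Section Ore.
Variables (B : pzRingType) (s : nat) (D : comm_ders B s).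

Local Notation ore := (ore D).
Local Notation ore_mon := (ore_mon D).

Implicit Types (f g : ore) (al be : 'X_{1..s}).

Definition ore_scale (b : B) : ore -> ore :=
  malg_lift (fun al c => ore_mon (b * c) al).

Definition ore_lmul_t (i : 'I_s) : ore -> ore :=
  malg_lift (fun al b => ore_mon b (mmul al (ucm i)) + ore_mon (D i b) al).

Definition ore_lmul_mon al (g : ore) : ore :=
  foldr (fun i => iter (al i) (ore_lmul_t i)) g (enum 'I_s).

Definition ore_mul (f g : ore) : ore :=
  malg_lift (fun al b => ore_scale b (ore_lmul_mon al g)) f.

Lemma ore_monD al b c : ore_mon (b + c) al = ore_mon b al + ore_mon c al.
Proof. by rewrite ore_mon.unlock monalgUD. Qed.

Lemma ore_ext (V : zmodType) (F F' : ore -> V) :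
  {morph F : f g / f + g} -> {morph F' : f g / f + g} ->
  (forall b al, F (ore_mon b al) = F' (ore_mon b al)) -> F =1 F'.
Proof. by rewrite ore_mon.unlock; apply: malg_ext. Qed.

Lemma ore_mon0 al : ore_mon 0 al = 0.
Proof. by rewrite ore_mon.unlock monalgU0. Qed.

Lemma ore_sum_mon f : f = \sum_(al <- msupp f) ore_mon f@_al al.
Proof. by rewrite ore_mon.unlock; apply: monalgE. Qed.

Lemma ore_lift_mon (V : zmodType) (h : 'X_{1..s} -> B -> V) b al :
  (forall al b c, h al (b + c) = h al b + h al c) ->
  malg_lift h (ore_mon b al) = h al b.
Proof. by move=> hD; rewrite ore_mon.unlock; apply: malg_liftU. Qed.

Let scale_add b al c c' :
  ore_mon (b * (c + c')) al = ore_mon (b * c) al + ore_mon (b * c') al.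
Proof. by rewrite mulrDr ore_monD. Qed.

Lemma ore_scaleD b : {morph ore_scale b : f g / f + g}.
Proof. exact: malg_liftD (scale_add b). Qed.

Lemma ore_scale_mon b c al : ore_scale b (ore_mon c al) = ore_mon (b * c) al.
Proof. exact: ore_lift_mon (scale_add b). Qed.

Let lmul_t_add i al b c :
  ore_mon (b + c) (mmul al (ucm i)) + ore_mon (D i (b + c)) al =
  ore_mon b (mmul al (ucm i)) + ore_mon (D i b) al
  + (ore_mon c (mmul al (ucm i)) + ore_mon (D i c) al).
Proof. by rewrite derD !ore_monD addrACA. Qed.

Lemma ore_lmul_tD i : {morph ore_lmul_t i : f g / f + g}.
Proof. exact: malg_liftD (lmul_t_add i). Qed.

Lemma ore_lmul_t_mon i b al :
  ore_lmul_t i (ore_mon b al) = ore_mon b (mmul al (ucm i)) + ore_mon (D i b) al.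
Proof. exact: ore_lift_mon (lmul_t_add i). Qed.

Lemma ore_lmul_tC i j f :
  ore_lmul_t i (ore_lmul_t j f) = ore_lmul_t j (ore_lmul_t i f).
Proof.
move: f; apply: ore_ext => [f g|f g|b al]; try by rewrite !ore_lmul_tD.
rewrite !(ore_lmul_t_mon, ore_lmul_tD) derC -!mulmA (mulmC (ucm i)).
by rewrite addrACA.
Qed.

Lemma ore_scaleDl b c f : ore_scale (b + c) f = ore_scale b f + ore_scale c f.
Proof.
move: f; apply: ore_ext => [f g|f g|d al]; rewrite ?ore_scaleD //.
  by rewrite addrACA.
by rewrite !ore_scale_mon mulrDl ore_monD.
Qed.

Lemma ore_scaleA b c f : ore_scale b (ore_scale c f) = ore_scale (b * c) f.
Proof.
move: f; apply: ore_ext => [f g|f g|d al]; rewrite ?ore_scaleD //.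
by rewrite !ore_scale_mon mulrA.
Qed.

Lemma ore_scale1 f : ore_scale 1 f = f.
Proof.
move: f; apply: ore_ext => [f g|f g|d al]; rewrite ?ore_scaleD //.
by rewrite !ore_scale_mon mul1r.
Qed.

Lemma ore_lmul_t_scale i b f :
  ore_lmul_t i (ore_scale b f) = ore_scale b (ore_lmul_t i f) + ore_scale (D i b) f.
Proof.
move: f; apply: ore_ext => [f g|f g|d al].
- by rewrite !(ore_scaleD, ore_lmul_tD).
- by rewrite !(ore_scaleD, ore_lmul_tD) addrACA.
rewrite !(ore_scale_mon, ore_lmul_t_mon, ore_scaleD) derM ore_monD.
by rewrite -addrA [X in _ + X]addrC.
Qed.

Lemma ore_lmul_mon_ind (P : ore -> Prop) al g :
  (forall i f, P f -> P (ore_lmul_t i f)) -> P g -> P (ore_lmul_mon al g).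
Proof.
move=> Pt Pg; rewrite /ore_lmul_mon; elim: (enum _) => //= i r IH.
by elim: (al i) => //= n; apply: Pt.
Qed.

Lemma ore_lmul_mon_morph (F : ore -> ore) al g :
  (forall i f, F (ore_lmul_t i f) = ore_lmul_t i (F f)) ->
  F (ore_lmul_mon al g) = ore_lmul_mon al (F g).
Proof.
move=> Ft; rewrite /ore_lmul_mon; elim: (enum _) => //= i r IH.
by rewrite -IH; elim: (al i) => //= n {}IH; rewrite Ft IH.
Qed.

Lemma ore_lmul_monD al : {morph ore_lmul_mon al : f g / f + g}.
Proof.
move=> f g; rewrite /ore_lmul_mon; elim: (enum _) => //= i r ->.
by elim: (al i) => //= n ->; rewrite ore_lmul_tD.
Qed.

Lemma ore_lmul_mon1 g : ore_lmul_mon mone g = g.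
Proof. by rewrite /ore_lmul_mon; elim: (enum _) => //= i r ->; rewrite cm1. Qed.

Lemma ore_lmul_monM al be g :
  ore_lmul_mon (mmul al be) g = ore_lmul_mon al (ore_lmul_mon be g).
Proof.
have iterC n i (r : seq 'I_s) f : iter n (ore_lmul_t i)
    (foldr (fun i => iter (al i) (ore_lmul_t i)) f r) =
    foldr (fun i => iter (al i) (ore_lmul_t i)) (iter n (ore_lmul_t i) f) r.
  elim: r => //= j r <-; elim: (al j) => //= p <-.
  by elim: n => //= n ->; rewrite ore_lmul_tC.
rewrite /ore_lmul_mon; elim: (enum _) => //= i r ->.
by rewrite cmM iterD iterC.
Qed.

Lemma ore_lmul_monU i g : ore_lmul_mon (ucm i) g = ore_lmul_t i g.
Proof.
rewrite /ore_lmul_mon.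
have -> r : uniq r -> foldr (fun j => iter ((ucm i) j) (ore_lmul_t j)) g r =
    if i \in r then ore_lmul_t i g else g.
  elim: r => //= j r IH /andP[jr /IH ->]; rewrite cmU inE eq_sym.
  by case: eqP jr => //= -> /negPf ->.
  by rewrite mem_enum.
exact: enum_uniq.
Qed.

Lemma mon_ind (P : 'X_{1..s} -> Prop) :
  P mone -> (forall i al, P al -> P (mmul al (ucm i))) -> forall al, P al.
Proof.
move=> P1 PU al; have [n] := ubnP (mdeg al); elim: n al => // n IH al ltn.
have [->//|/eqP al1] := eqVneq al mone.
have [i ali|al0] := pickP (fun i => al i != 0%N); last first.
  by case: al1; apply/eqP/cmP => i; rewrite cm1; have /negbFE/eqP := al0 i.
have Dal : al = mmul (divcm al (ucm i)) (ucm i).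
  apply/eqP/cmP => j; rewrite cmM divcmE cmU subnK //.
  by case: eqP => // <-; rewrite lt0n.
by rewrite Dal; apply/PU/IH; move: ltn; rewrite {1}Dal mdegM mdegU addn1.
Qed.

Lemma ore_lmul_mon_mon1 al be : ore_lmul_mon al (ore_mon 1 be) = ore_mon 1 (mmul be al).
Proof.
elim/mon_ind: al be => [|i al IH] be; first by rewrite ore_lmul_mon1 mulm1.
rewrite ore_lmul_monM ore_lmul_monU ore_lmul_t_mon der1 ore_lmul_monD.
have F0 : ore_lmul_mon al 0 = 0.
  by apply: (addIr (ore_lmul_mon al 0)); rewrite -ore_lmul_monD !add0r.
by rewrite ore_mon0 F0 addr0 IH -mulmA (mulmC (ucm i)).
Qed.

Let mul_add g al b c :
  ore_scale (b + c) (ore_lmul_mon al g) =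
  ore_scale b (ore_lmul_mon al g) + ore_scale c (ore_lmul_mon al g).
Proof. exact: ore_scaleDl. Qed.

Fact ore_mulDl : left_distributive ore_mul +%R.
Proof. by move=> f f' g; apply: malg_liftD; apply: mul_add. Qed.

Lemma ore_mul_mon b al g : ore_mul (ore_mon b al) g = ore_scale b (ore_lmul_mon al g).
Proof. exact: ore_lift_mon (mul_add g). Qed.

Fact ore_mulDr : right_distributive ore_mul +%R.
Proof.
move=> f g g'; move: f; apply: ore_ext => [f f'|f f'|b al].
- by rewrite ore_mulDl.
- by rewrite !ore_mulDl addrACA.
by rewrite !ore_mul_mon ore_lmul_monD ore_scaleD.
Qed.

Fact ore_mul1l : left_id (ore_mon 1 mone) ore_mul.
Proof. by move=> g; rewrite ore_mul_mon ore_lmul_mon1 ore_scale1. Qed.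

Fact ore_mul1r : right_id (ore_mon 1 mone) ore_mul.
Proof.
apply: ore_ext => [f f'|f f'|b al] //; first by rewrite ore_mulDl.
by rewrite ore_mul_mon ore_lmul_mon_mon1 mul1m ore_scale_mon mulr1.
Qed.

Lemma ore_mul_scale b f g : ore_mul (ore_scale b f) g = ore_scale b (ore_mul f g).
Proof.
move: f; apply: ore_ext => [f f'|f f'|c al].
- by rewrite ore_scaleD ore_mulDl.
- by rewrite ore_mulDl ore_scaleD.
by rewrite ore_scale_mon !ore_mul_mon ore_scaleA.
Qed.

Lemma ore_mul_lmul_t i f g : ore_mul (ore_lmul_t i f) g = ore_lmul_t i (ore_mul f g).
Proof.
move: f; apply: ore_ext => [f f'|f f'|c al].
- by rewrite ore_lmul_tD ore_mulDl.
- by rewrite ore_mulDl ore_lmul_tD.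
rewrite ore_lmul_t_mon ore_mulDl !ore_mul_mon ore_lmul_t_scale.
by rewrite mulmC ore_lmul_monM ore_lmul_monU.
Qed.

Fact ore_mulA : associative ore_mul.
Proof.
move=> f g h; move: f; apply: ore_ext => [f f'|f f'|b al].
- by rewrite ore_mulDl.
- by rewrite !ore_mulDl.
rewrite !ore_mul_mon ore_mul_scale; congr (ore_scale _ _).
by rewrite (@ore_lmul_mon_morph (ore_mul^~ h)) // => i f; apply: ore_mul_lmul_t.
Qed.

HB.instance Definition _ := GRing.Zmodule_isPzRing.Build ore
  ore_mulA ore_mul1l ore_mul1r ore_mulDl ore_mulDr.

Definition ore_const (b : B) : ore := ore_mon b mone.
Definition ore_t (i : 'I_s) : ore := ore_mon 1 (ucm i).

Lemma ore_constD b c : ore_const (b + c) = ore_const b + ore_const c.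
Proof. exact: ore_monD. Qed.

Lemma ore_const1 : ore_const 1 = 1. Proof. by []. Qed.

Lemma ore_mon_mulE b al g : ore_mon b al * g = ore_scale b (ore_lmul_mon al g).
Proof. exact: ore_mul_mon. Qed.

Lemma ore_constM b c : ore_const (b * c) = ore_const b * ore_const c.
Proof. by rewrite ore_mon_mulE ore_lmul_mon1 ore_scale_mon. Qed.

Lemma ore_t_mulE i g : ore_t i * g = ore_lmul_t i g.
Proof. by rewrite ore_mon_mulE ore_lmul_monU ore_scale1. Qed.

Lemma ore_t_comm i j : ore_t i * ore_t j = ore_t j * ore_t i.
Proof. by rewrite -[LHS]mulr1 -[RHS]mulr1 -!mulrA !ore_t_mulE ore_lmul_tC. Qed.

Lemma ore_t_const i b :
  ore_t i * ore_const b = ore_const b * ore_t i + ore_const (D i b).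
Proof.
rewrite ore_t_mulE ore_lmul_t_mon; congr (_ + _).
by rewrite ore_mon_mulE ore_lmul_mon1 ore_scale_mon mulr1 mul1m.
Qed.

Lemma ore_monE b al :
  ore_mon b al = ore_const b * \prod_(i < s) ore_t i ^+ al i.
Proof.
rewrite ore_mon_mulE ore_lmul_mon1.
suff -> : \prod_(i < s) ore_t i ^+ al i = ore_mon 1 al.
  by rewrite ore_scale_mon mulr1.
have -> : ore_mon 1 al = ore_lmul_mon al 1 by rewrite ore_lmul_mon_mon1 mul1m.
rewrite /ore_lmul_mon -[index_enum _]enumT.
elim: (enum _) => [|i r IH] /=; first by rewrite big_nil.
rewrite big_cons IH; elim: (al i) => [|n IHn] /=; first by rewrite mul1r.
by rewrite exprS -mulrA IHn ore_t_mulE.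
Qed.

Lemma ore_expand f :
  f = \sum_(al <- msupp f) ore_const f@_al * \prod_(i < s) ore_t i ^+ al i.
Proof. by rewrite {1}[f]ore_sum_mon; apply: eq_bigr => al _; rewrite -ore_monE. Qed.

End Ore.

(* Main.v *)
(* Let B be the algebra of constants.  The map
   a |-> sum_(k < N) (-1)^k / k! delta_j^k(a) x_j^k is left B-linear, fixes
   ker delta_j and sends every a with delta_j^N(a) = 0 into it.  Composing over
   j shows that the constants of A/(m) come from B; and since [x_i, m] <= m
   gives (m) = m A, also that (m) meets B in m.  Let now J be a nonzero ideal of
   the Ore extension.  Iterating the commutators with the t_i, which
   differentiate coefficients, gives a nonzero element of J with coefficients in
   the simple ring B/m; one with fewest terms can be normalized to have a
   coefficient 1, and its coefficients then lie in the centre Z.  On Z[t] the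
   commutators with the x_i are, up to sign, the partial derivatives in the t_i,
   so characteristic zero yields a nonzero element of J in Z, and hence 1. *)
Require Import Defs.
From HB Require Import structures.
From mathcomp Require Import all_boot all_algebra.
From mathcomp Require Import finmap boolp classical_sets monalg.

Set Implicit Arguments.
Unset Strict Implicit.
Unset Printing Implicit Defensive.

Import GRing.Theory.
Local Open Scope ring_scope.
Local Open Scope classical_set_scope.

(** * Two-sided ideals and their quotients *)

Section IdealTheory.
Variables (R : pzRingType) (I : ideal R).

Lemma idealN a : I a -> I (- a).
Proof. by rewrite -mulN1r; apply: idealMl. Qed.

Lemma idealB a b : I a -> I b -> I (a - b).
Proof. by move=> Ia Ib; apply: idealD => //; apply: idealN. Qed.

Lemma ideal_sum (T : Type) (r : seq T) (P : pred T) (F : T -> R) :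
  (forall k, P k -> I (F k)) -> I (\sum_(k <- r | P k) F k).
Proof.
move=> IF; apply: (big_ind (fun a => I a)) => //; first exact: ideal0.
by move=> a b; apply: idealD.
Qed.

Lemma ideal_lie a b : I b -> I (lie a b).
Proof. by move=> Ib; apply: idealB; [apply: idealMl | apply: Defs.idealMr]. Qed.

Lemma ideal1_setT : I 1 -> ideal_set I = setT.
Proof.
by move=> I1; apply/seteqP; split=> // a _; rewrite -[a]mulr1; apply: idealMl.
Qed.

Lemma quot_pi_eq0 a : quot_pi I a = 0 <-> I a.
Proof.
have pi0 : quot_pi I 0 = 0.
  by apply: (addIr (quot_pi I 0)); rewrite -quot_piD !add0r.
by rewrite -pi0 quot_pi_eq subr0.
Qed.

Lemma quot_pi0 : quot_pi I 0 = 0.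
Proof. by apply/quot_pi_eq0; apply: ideal0. Qed.

End IdealTheory.

(** * Projections onto the kernels of the derivations *)

Section ConstantProjection.
Variables (K : fieldType) (K_char0 : [pchar K] =i pred0).
Variables (A : algType K) (s : nat) (D : comm_ders A s).
Hypothesis D_linear : forall i, scalable (D i).
Hypothesis D_nilp : forall i, locally_nilpotent (D i).
Variable x : 'I_s -> A.
Hypothesis D_x : forall i j, D i (x j) = (i == j)%:R.

Lemma der_sum i (T : Type) (r : seq T) (P : pred T) (F : T -> A) :
  D i (\sum_(k <- r | P k) F k) = \sum_(k <- r | P k) D i (F k).
Proof. exact: (big_morph (D i) (@derD _ _ D i) (der0 D i)). Qed.

Lemma der_iterC i j n a : D i (iter n (D j) a) = iter n (D j) (D i a).
Proof. by elim: n => //= n <-; rewrite derC. Qed.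

Lemma iter_der0 j n : iter n (D j) 0 = 0.
Proof. by elim: n => //= n ->; rewrite der0. Qed.

Lemma iter_der_le j n p a : (n <= p)%N -> iter n (D j) a = 0 -> iter p (D j) a = 0.
Proof. by move=> /subnK <-; rewrite iterD => ->; rewrite iter_der0. Qed.

Lemma der_x_neq i j k : i != j -> D i (x j ^+ k) = 0.
Proof.
move=> /negPf nij; elim: k => [|k IH]; first by rewrite expr0 der1.
by rewrite exprS derM D_x nij IH mul0r mulr0 addr0.
Qed.

Lemma der_x_eq j k : D j (x j ^+ k) = x j ^+ k.-1 *+ k.
Proof.
elim: k => [|k IH]; first by rewrite expr0 der1.
rewrite exprS derM D_x eqxx mul1r IH; case: k {IH} => [|k] /=.
  by rewrite mulr0 addr0.
by rewrite mulrnAr -exprS -mulrS.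
Qed.

(** A truncated Taylor expansion: formally, a evaluated at x_j = 0. Keeping the powers of x_j on the
    right makes it linear for left multiplication by the kernel of [D j]. *)
Definition const_proj j N a : A :=
  \sum_(k < N) ((-1) ^+ k / (k`!)%:R) *: (iter k (D j) a * x j ^+ k).

(** With the term k = 0 split off, a differs from its projection only by terms that contain a proper
    derivative of a. *)
Lemma const_projS j N a :
  const_proj j N.+1 a =
  a + \sum_(k < N) ((-1) ^+ k.+1 / (k.+1`!)%:R) *:
        (iter k.+1 (D j) a * x j ^+ k.+1).
Proof.
by rewrite /const_proj big_ord_recl /= expr0 fact0 divr1 scale1r expr0 mulr1.
Qed.

Lemma der_const_proj_neq i j N a : i != j ->
  D i (const_proj j N a) = const_proj j N (D i a).
Proof.
move=> nij; rewrite /const_proj der_sum; apply: eq_bigr => k _.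
by rewrite D_linear derM (der_x_neq _ nij) mulr0 addr0 der_iterC.
Qed.

(* The sum of the derivatives of the terms telescopes. *)
Lemma der_const_proj j N a :
  D j (const_proj j N.+1 a) =
  ((-1) ^+ N / (N`!)%:R) *: (iter N.+1 (D j) a * x j ^+ N).
Proof.
elim: N => [|N IH].
  by rewrite /const_proj big_ord1 /= expr0 mulr1 fact0 divr1 !scale1r mulr1.
rewrite /const_proj big_ord_recr derD [X in D j X + _]/= -/(const_proj j N.+1 a) IH.
rewrite D_linear derM der_x_eq /= scalerDr addrCA -[RHS]addr0; congr (_ + _).
rewrite mulrnAr -scaler_nat scalerA -scalerDl.
suff -> : (-1) ^+ N / (N`!)%:R + (-1) ^+ N.+1 / (N.+1`!)%:R * N.+1%:R = 0 :> K.
  by rewrite scale0r.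
have n0 k : k.+1%:R != 0 :> K by rewrite ((pcharf0P _).1 K_char0).
rewrite factS natrM invfM exprS mulN1r -mulrA mulrAC.
by rewrite mulVf // mul1r mulNr subrr.
Qed.

Lemma der_const_proj_eq j N a : iter N (D j) a = 0 -> D j (const_proj j N a) = 0.
Proof.
case: N => [|N] E; first by rewrite /const_proj big_ord0 der0.
by rewrite der_const_proj E mul0r scaler0.
Qed.

Lemma const_proj_id j N a : D j a = 0 -> const_proj j N.+1 a = a.
Proof.
move=> Da; rewrite const_projS big1 ?addr0 // => k _.
by rewrite iterSr Da iter_der0 mul0r scaler0.
Qed.

Lemma const_projMl j N y a : D j y = 0 ->
  const_proj j N (y * a) = y * const_proj j N a.
Proof.
move=> Dy; rewrite /const_proj mulr_sumr; apply: eq_bigr => k _.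
rewrite -scalerAr mulrA; congr (_ *: (_ * _)).
by elim: (k : nat) => //= n ->; rewrite derM Dy mul0r add0r.
Qed.

Lemma const_proj_sum j N n (F : 'I_n -> A) :
  const_proj j N (\sum_k F k) = \sum_k const_proj j N (F k).
Proof.
rewrite /const_proj exchange_big; apply: eq_bigr => k _ /=.
rewrite -scaler_sumr -mulr_suml; congr (_ *: (_ * _)).
by elim: (k : nat) => //= p ->; rewrite der_sum.
Qed.

(** By [const_projS], a is its projection minus terms in which derivatives of a, of smaller
    nilpotency order, multiply powers of x_j. Induction on that order removes one derivation at a
    time. *)
Lemma generated_by_constants (S : set A) :
  (forall a b, S a -> S b -> S (a + b)) ->
  (forall a b, S a -> S b -> S (a * b)) ->
  (forall y : constants D, S (val y)) -> (forall i, S (x i)) ->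
  forall a, S a.
Proof.
move=> SD SM SC Sx.
have SC' a : (forall i, D i a = 0) -> S a.
  move=> /constP Da; exact: (SC (Sub a Da)).
have SZ (c : K) a : S a -> S (c *: a).
  move=> Sa; rewrite -mulr_algl; apply: (SM) => //; apply: SC' => i.
  by rewrite D_linear der1 scaler0.
have SX j k : S (x j ^+ k).
  elim: k => [|k IH]; last by rewrite exprS; apply: SM.
  by apply: SC' => i; rewrite expr0 der1.
have S0 : S 0 by apply: SC' => i; rewrite der0.
(* The list r contains every index whose derivation does not kill a. *)
suff Sr (r : seq 'I_s) a : (forall i, i \notin r -> D i a = 0) -> S a.
  by move=> a; apply: (Sr (enum 'I_s)) => i; rewrite mem_enum.
elim: r a => [|j r IH] a Da; first by apply: SC' => i; apply: Da.
have [N] := D_nilp j a; elim/ltn_ind: N a Da => -[|N] IHN a Da DNa.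
  by rewrite -[a]/(iter 0 (D j) a) DNa.
have Sphi : S (const_proj j N.+1 a).
  apply: IH => i ir; have [->|nij] := eqVneq i j.
    exact: der_const_proj_eq.
  rewrite der_const_proj_neq // Da ?inE ?negb_or ?nij //.
  (* Here [const_proj_id] is applied to 0, whose projection is 0. *)
  by rewrite const_proj_id ?der0.
rewrite -(addrK (\sum_(k < N) ((-1) ^+ k.+1 / (k.+1`!)%:R) *:
        (iter k.+1 (D j) a * x j ^+ k.+1)) a) -const_projS.
apply: (SD) => //; rewrite -sumrN; apply: (big_ind S) => // k _.
rewrite -scaleNr; apply: SZ; apply: (SM) => //.
apply: (IHN (N - k)%N); first by rewrite ltnS leq_subr.
  by move=> i ir; rewrite der_iterC Da // iter_der0.
by rewrite -iterD addnS subnK // ltnW.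
Qed.

(** * The ideal (m) of A and the constants of A/(m) *)

Variable m : ideal (constants D).
Hypothesis x_m : forall i (y : constants D), m y ->
  (val @` ideal_set m) (lie (x i) (val y)).

(** This is the right ideal mA. Having no factors to the left of m, its elements can be projected
    factor by factor. *)
Definition right_gen : set A := [set u | exists n (y : 'I_n -> constants D) a,
  (forall k, m (y k)) /\ u = \sum_(k < n) val (y k) * a k].

Lemma right_genD u v : right_gen u -> right_gen v -> right_gen (u + v).
Proof.
move=> [n [y [a [my ->]]]] [n' [y' [a' [my' ->]]]].
pose f T (g : 'I_n -> T) (h : 'I_n' -> T) k :=
  match split k with inl i => g i | inr j => h j end.
exists (n + n')%N, (f _ y y'), (f _ a a'); split.
  by move=> k; rewrite /f; case: (split k).
rewrite big_split_ord /f /=; congr (_ + _); apply: eq_bigr => i _.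
  by have /= -> := unsplitK (inl i : 'I_n + 'I_n').
by have /= -> := unsplitK (inr i : 'I_n + 'I_n').
Qed.

Lemma right_gen1 y a : m y -> right_gen (val y * a).
Proof.
by move=> my; exists 1%N, (fun=> y), (fun=> a); split=> //; rewrite big_ord1.
Qed.

Lemma right_gen_sum n (F : 'I_n -> A) :
  (forall k, right_gen (F k)) -> right_gen (\sum_k F k).
Proof.
move=> RF; apply: big_ind => //; last exact: right_genD.
by rewrite -[0](mulr0 (val (0 : constants D))); apply/right_gen1/ideal0.
Qed.

Lemma right_genMr u b : right_gen u -> right_gen (u * b).
Proof.
move=> [n [y [a [my ->]]]]; rewrite mulr_suml; apply: right_gen_sum => k.
by rewrite -mulrA; apply: right_gen1.
Qed.

(* As [x_i, m] <= m, the elements a with a m <= m A form a subring containing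
   the x_i and the constants. *)
Lemma right_gen_left a y : m y -> right_gen (a * val y).
Proof.
move: a y.
apply: (@generated_by_constants (fun a => forall y, m y -> right_gen (a * val y))).
- by move=> a b Sa Sb y my; rewrite mulrDl; apply: right_genD; auto.
- move=> a b Sa Sb y my; rewrite -mulrA.
  have [n [z [c [mz ->]]]] := Sb _ my; rewrite mulr_sumr.
  by apply: right_gen_sum => k; rewrite mulrA; apply/right_genMr/Sa.
- move=> b y my; rewrite -[_ * _]mulr1 -(rmorphM val).
  by apply: right_gen1; apply: idealMl.
(* x_i y = [x_i, y] + y x_i, and the commutator lies in m again. *)
move=> i y my; rewrite -(subrK (val y * x i) (x i * val y)).
apply: right_genD; last exact: right_gen1.
have [z mz Ez] := x_m i my; rewrite -[_ - _]/(lie (x i) (val y)) -Ez.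
by rewrite -[\val z]mulr1; apply: right_gen1.
Qed.

Lemma ext_ideal_right_gen u : ext_ideal m u -> right_gen u.
Proof.
move=> [n [c [y [b [my ->]]]]]; apply: right_gen_sum => k.
by have [z mz <-] := my k; apply/right_genMr/right_gen_left.
Qed.

Lemma ext_ideal_sub y : m y -> ext_ideal m (val y).
Proof.
move=> my; exists 1%N, (fun=> 1), (fun=> val y), (fun=> 1); split=> [_|].
  by exists y.
by rewrite big_ord1 mul1r mulr1.
Qed.

(** Write u as a sum of y_k a_k with y_k in m. Each projection fixes the constant u and passes
    through the y_k to the a_k, so after all of them the a_k are constants. *)
Lemma ext_ideal_constants (u : constants D) : ext_ideal m (val u) -> m u.
Proof.
move=> /ext_ideal_right_gen Ru.
suff [n [y [a [my Da Eu]]]] : exists n (y : 'I_n -> constants D) a,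
  [/\ forall k, m (y k), forall k i, i \in enum 'I_s -> D i (a k) = 0 &
      val u = \sum_k val (y k) * a k].
  have aC k : a k \in const_pred D.
    by apply/constP => i; apply: Da; rewrite mem_enum.
  suff -> : u = \sum_k y k * (Sub (a k) (aC k) : constants D).
    by apply: ideal_sum => k _; apply: Defs.idealMr.
  by apply: val_inj; rewrite Eu rmorph_sum; apply: eq_bigr => k _; rewrite rmorphM.
elim: (enum _) => [|j r [n [y [a [my Da Eu]]]]].
  by have [n [y [a [my Eu]]]] := Ru; exists n, y, a.
(* One truncation order has to serve all the a_k. *)
have [N DN] : exists N, forall k, iter N (D j) (a k) = 0.
  have /choice [p Dp] k : exists p, iter p (D j) (a k) = 0 by apply: D_nilp.
  exists (\max_k p k) => k; apply: iter_der_le (Dp k); exact: leq_bigmax.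
exists n, y, (fun k => const_proj j N.+1 (a k)); split=> // [k i|].
  rewrite inE; case: eqVneq => [->|nij] /= ir.
    by apply: der_const_proj_eq; apply: iter_der_le (DN k).
  by rewrite der_const_proj_neq // Da // const_proj_id ?der0.
rewrite -[LHS](@const_proj_id j N) ?der_val // Eu const_proj_sum.
by apply: eq_bigr => k _; rewrite const_projMl ?der_val.
Qed.

(** If the derivatives of a representative lie in (m), projecting changes it only by an element of
    (m). Projecting for every j makes it constant. *)
Lemma ext_quot_constants u : (forall i, ext_quot_ders m i u = 0) ->
  exists b : constants D, u = quot_pi (ext_ideal m) (val b).
Proof.
move=> Du.
suff [a Eu Da] : exists2 a, u = quot_pi (ext_ideal m) a &
    forall i, i \in enum 'I_s -> D i a = 0.
  have aC : a \in const_pred D by apply/constP => i; apply: Da; rewrite mem_enum.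
  by exists (Sub a aC).
elim: (enum _) => [|j r [a Eu Da]].
  by have [a ->] := quot_pi_surj u; exists a.
have [N DN] := D_nilp j a.
exists (const_proj j N.+1 a) => [|i].
  rewrite Eu; apply/quot_pi_eq; rewrite const_projS opprD addNKr.
  apply: idealN; apply: ideal_sum => k _; rewrite -mulr_algl; apply: idealMl.
  (* The first derivative lies in (m) by [Du], the higher ones by stability of (m). *)
  apply: Defs.idealMr; have := Du j; rewrite Eu ext_quot_dersE => /quot_pi_eq0 Ij.
  by rewrite iterSr; elim: (k : nat) => //= p; apply: ext_ideal_stable.
rewrite inE; case: eqVneq => [->|nij] /= ir.
  by apply: der_const_proj_eq; apply: iter_der_le DN.
by rewrite der_const_proj_neq // Da // const_proj_id ?der0.
Qed.

Lemma ext_quot_nilp i : locally_nilpotent (ext_quot_ders m i).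
Proof.
move=> u; have [a ->] := quot_pi_surj u; have [n Dn] := D_nilp i a; exists n.
suff -> : iter n (ext_quot_ders m i) (quot_pi _ a) =
          quot_pi (ext_ideal m) (iter n (D i) a) by rewrite Dn quot_pi0.
by elim: n {Dn} => // n IH; rewrite !iterS IH ext_quot_dersE.
Qed.

(** The quotient carries only a ring structure, so the division by n + 1 takes place on a
    representative in A, as multiplication by a scalar multiple of 1. *)
Lemma quot_mulrn_eq0 (I : ideal A) (u : quot_ring I) n : u *+ n.+1 = 0 -> u = 0.
Proof.
have [a ->] := quot_pi_surj u => E; apply/quot_pi_eq0.
have /quot_pi_eq0 Ia : quot_pi I (a *+ n.+1) = 0.
  rewrite -E; elim: n.+1 => [|p IH]; first by rewrite !mulr0n quot_pi0.
  by rewrite !mulrS quot_piD IH.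
have -> : a = (n.+1%:R^-1)%:A * (a *+ n.+1).
  rewrite mulr_algl -scaler_nat scalerA mulVf ?scale1r //.
  by rewrite ((pcharf0P _).1 K_char0).
exact: idealMl.
Qed.

End ConstantProjection.

Lemma divcm_ucmK s (al : 'X_{1..s}) i : (0 < al i)%N ->
  mmul (divcm al (ucm i)) (ucm i) = al.
Proof.
move=> al0; apply/eqP/cmP => k; rewrite cmM divcmE cmU subnK //.
by case: eqP => // <-.
Qed.

(** * Coefficients and commutators in an Ore extension *)

Section OreCoefficients.
Variables (B : pzRingType) (s : nat) (D : comm_ders B s).
Implicit Types (f g : ore D) (al be : 'X_{1..s}).

Definition ore_coef al f : B := f@_al.

Lemma ore_coefD al : {morph ore_coef al : f g / f + g}.
Proof. exact: mcoeffD. Qed.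

Lemma ore_coefB al f g : ore_coef al (f - g) = ore_coef al f - ore_coef al g.
Proof. exact: mcoeffB. Qed.

Lemma ore_coef0 al : ore_coef al (0 : ore D) = 0.
Proof. exact: mcoeff0. Qed.

Lemma ore_coef_mon al b be : ore_coef al (ore_mon D b be) = b *+ (be == al).
Proof. by rewrite /ore_coef ore_mon.unlock mcoeffU. Qed.

Lemma ore_coefP f g : (forall al, ore_coef al f = ore_coef al g) -> f = g.
Proof. by move=> E; apply/malgP. Qed.

Lemma ore_neq0 f : f <> 0 -> exists al, ore_coef al f <> 0.
Proof.
move=> f0; apply/not_existsP => Ef; apply: f0; apply: ore_coefP => al.
by rewrite ore_coef0; apply: contrapT; apply: Ef.
Qed.

Lemma ore_coef_constM al c f : ore_coef al (ore_const D c * f) = c * ore_coef al f.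
Proof.
move: f; apply: ore_ext => [f g|f g|b be].
- by rewrite mulrDr ore_coefD.
- by rewrite ore_coefD mulrDr.
by rewrite ore_mon_mulE ore_lmul_mon1 ore_scale_mon !ore_coef_mon mulrnAr.
Qed.

(** Right multiplication by t_i only shifts exponents, whereas left multiplication also
    differentiates the coefficients. *)
Lemma ore_coef_tM al i f :
  ore_coef al (ore_t D i * f) = ore_coef al (f * ore_t D i) + D i (ore_coef al f).
Proof.
move: f; apply: ore_ext => [f g|f g|b be].
- by rewrite mulrDr ore_coefD.
- by rewrite mulrDl !ore_coefD derD addrACA.
rewrite ore_t_mulE ore_lmul_t_mon ore_mon_mulE ore_lmul_mon_mon1 ore_scale_mon.
rewrite ore_coefD !ore_coef_mon mulr1 mulmC; congr (_ + _).
by case: (_ == _); rewrite ?mulr1n ?mulr0n ?der0.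
Qed.

Lemma ore_coef_lie_t al i f : ore_coef al (lie (ore_t D i) f) = D i (ore_coef al f).
Proof. by rewrite ore_coefB ore_coef_tM addrAC subrr add0r. Qed.

(** X and the t_j satisfy the Weyl algebra relations. Where al i = 0 the truncated exponent [divcm]
    is harmless, its coefficient being 0. *)
Lemma ore_lmul_mon_coord al i X : (forall j, D j X = (j == i)%:R) ->
  ore_lmul_mon al (ore_const D X) =
  ore_mon D X al + ore_mon D (al i)%:R (divcm al (ucm i)).
Proof.
move=> DX; elim/mon_ind: al => [|j al IH].
  by rewrite ore_lmul_mon1 cm1 ore_mon0 addr0.
rewrite mulmC ore_lmul_monM ore_lmul_monU IH ore_lmul_tD !ore_lmul_t_mon DX.
have Dn n : D j n%:R = 0.
  by elim: n => [|n IHn]; rewrite ?der0 // -addn1 natrD derD IHn der1 addr0.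
rewrite Dn ore_mon0 addr0 -addrA (mulmC (ucm j)); congr (_ + _).
rewrite cmM cmU.
have [->|nij] /= := eqVneq j i.
  rewrite addn1.
  have -> : divcm (mmul al (ucm i)) (ucm i) = al.
    by apply/eqP/cmP => k; rewrite divcmE cmM addnK.
  case: (posnP (al i)) => [->|al0]; first by rewrite ore_mon0 addr0.
  by rewrite divcm_ucmK // -ore_monD -natrD.
rewrite ore_mon0 add0r addn0; case: (posnP (al i)) => [->|al0].
  by rewrite !ore_mon0.
congr (ore_mon _ _ _); apply/eqP/cmP => k.
rewrite cmM !divcmE cmM !cmU; case: (eqVneq i k) => [<-|_].
  by rewrite (negPf nij) !addn0.
by rewrite !subn0.
Qed.

(** The last term is the coefficient of the formal partial derivative of f in t_i. It is all that
    remains of [f, X] when the coefficients commute with X. *)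
Lemma ore_coefM_coord al i X f : (forall j, D j X = (j == i)%:R) ->
  ore_coef al (f * ore_const D X) =
  ore_coef al f * X + ore_coef (mmul al (ucm i)) f *+ (al i).+1.
Proof.
move=> DX; move: f; apply: ore_ext => [f g|f g|b be].
- by rewrite mulrDl ore_coefD.
- by rewrite !ore_coefD mulrDl mulrnDl addrACA.
rewrite ore_mon_mulE (ore_lmul_mon_coord _ DX) ore_scaleD !ore_scale_mon.
rewrite ore_coefD !ore_coef_mon mulrnAl; congr (_ + _).
(* For be i = 0 the truncated exponent may equal al, but the factor be i then vanishes. *)
case: (posnP (be i)) => [be0|be0].
  rewrite be0 mulr0 mul0rn; case: eqP => [Ebe|]; last by rewrite mul0rn.
  by move: be0; rewrite Ebe cmM cmU eqxx addn1.
have -> : (divcm be (ucm i) == al) = (be == mmul al (ucm i)).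
  apply/eqP/eqP => [<-|->]; first by rewrite divcm_ucmK.
  by apply/eqP/cmP => k; rewrite divcmE cmM addnK.
case: eqP => [->|]; last by rewrite !mul0rn.
by rewrite cmM cmU eqxx addn1 !mulr1n mulr_natr.
Qed.

Lemma ore_lmul_mon_const al c : (forall j, D j c = 0) ->
  ore_lmul_mon al (ore_const D c) = ore_mon D c al.
Proof.
move=> Dc; elim/mon_ind: al => [|j al IH]; first by rewrite ore_lmul_mon1.
by rewrite mulmC ore_lmul_monM ore_lmul_monU IH ore_lmul_t_mon Dc ore_mon0 addr0 mulmC.
Qed.

Lemma ore_coefM_const al c f : (forall j, D j c = 0) ->
  ore_coef al (f * ore_const D c) = ore_coef al f * c.
Proof.
move=> Dc; move: f; apply: ore_ext => [f g|f g|b be].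
- by rewrite mulrDl ore_coefD.
- by rewrite ore_coefD mulrDl.
by rewrite ore_mon_mulE ore_lmul_mon_const // ore_scale_mon !ore_coef_mon mulrnAl.
Qed.

(** The support is finite, so a maximum of bounds works for all terms; this serves for nilpotency
    orders and for degrees. *)
Lemma ore_coef_bounded (P : 'X_{1..s} -> nat -> Prop) f :
  (forall al n p, (n <= p)%N -> P al n -> P al p) ->
  (forall al, exists n, P al n) ->
  exists n, forall al, ore_coef al f <> 0 -> P al n.
Proof.
move=> Pmono Pex.
suff [n Pn] : exists n, forall al, al \in (msupp f : seq _) -> P al n.
  by exists n => al /eqP f0; apply: Pn; rewrite -mcoeff_neq0.
elim: (msupp f : seq _) => [|al r [n Pn]]; first by exists 0%N.
have [p Pp] := Pex al; exists (maxn n p) => be; rewrite inE => /orP[/eqP ->|ber].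
  by apply: Pmono Pp; apply: leq_maxr.
by apply: Pmono (Pn _ ber); apply: leq_maxl.
Qed.

Hypothesis D_nilp : forall i, locally_nilpotent (D i).

(* The inner derivation of t_i acts on coefficients as D_i, so the last nonzero
   iterate of it on f is killed by D_i. *)
Lemma ore_ideal_const_coef (J : ideal (ore D)) f : J f -> f <> 0 ->
  exists g, [/\ J g, g <> 0 & forall i al, D i (ore_coef al g) = 0].
Proof.
move=> Jf f0.
suff [g [Jg g0 Dg]] : exists g, [/\ J g, g <> 0 &
    forall i, i \in enum 'I_s -> forall al, D i (ore_coef al g) = 0].
  by exists g; split=> // i al; apply: Dg; rewrite mem_enum.
elim: (enum _) => [|j r [g [Jg g0 Dg]]]; first by exists f.
have iter0 k : iter k (D j) 0 = 0 by elim: k => //= k ->; rewrite der0.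
have [n] : exists n, iter n (lie (ore_t D j)) g = 0.
  have [al n p np Dn||n Dn] :=
      @ore_coef_bounded (fun al n => iter n (D j) (ore_coef al g) = 0) g.
  - by rewrite -(subnK np) iterD Dn iter0.
  - by move=> al; apply: D_nilp.
  exists n; apply: ore_coefP => al; rewrite ore_coef0.
  have -> : ore_coef al (iter n (lie (ore_t D j)) g) = iter n (D j) (ore_coef al g).
    by elim: n {Dn} => //= n <-; rewrite ore_coef_lie_t.
  by have [->|/eqP g1] := eqVneq (ore_coef al g) 0; [apply: iter0 | apply: Dn].
elim: n g Jg g0 Dg => [|n IH] g Jg g0 Dg; first by move/g0.
rewrite iterSr; have [lg0 _|/eqP lg0] := eqVneq (lie (ore_t D j) g) 0.
  exists g; split=> // i; rewrite inE => /predU1P[->|/Dg//] al.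
  by rewrite -ore_coef_lie_t lg0 ore_coef0.
apply: IH => //; first exact: ideal_lie.
by move=> i ir al; rewrite ore_coef_lie_t derC Dg // der0.
Qed.

End OreCoefficients.

(** * Nonzero ideals of the Ore extension of A/(m) *)

Section Simplicity.
Variables (K : fieldType) (K_char0 : [pchar K] =i pred0).
Variables (A : algType K) (s : nat) (D : comm_ders A s).
Hypothesis D_linear : forall i, scalable (D i).
Hypothesis D_nilp : forall i, locally_nilpotent (D i).
Variable x : 'I_s -> A.
Hypothesis D_x : forall i j, D i (x j) = (i == j)%:R.
Variable m : ideal (constants D).
Hypothesis m_max : maximal_ideal m.
Hypothesis x_m : forall i (y : constants D), m y ->
  (val @` ideal_set m) (lie (x i) (val y)).
Hypothesis x_Z : forall i (z : constants D), center (quot_pi m z) ->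
  (val @` ideal_set m) (lie (x i) (val z)).

Local Notation E := (ext_quot_ders m).
Local Notation pi := (quot_pi (ext_ideal m)).
Local Notation coef := (@ore_coef (ext_quot m) s E).
Local Notation const := (@ore_const (ext_quot m) s E).

Let ext_const := ext_ideal_constants K_char0 D_linear D_nilp D_x x_m.
Let lift_const := ext_quot_constants K_char0 D_linear D_nilp D_x.

Lemma ext_quot_ders_val i (b : constants D) : E i (pi (val b)) = 0.
Proof. by rewrite ext_quot_dersE der_val quot_pi0. Qed.

(** Thus the quotient of the constants by m embeds in A/(m). *)
Lemma quot_pi_val_eq0 (b : constants D) : pi (val b) = 0 <-> m b.
Proof.
rewrite quot_pi_eq0; split; first exact: ext_const.
exact: ext_ideal_sub.
Qed.

Lemma max_ideal_not1 : ~ m 1.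
Proof. by move=> m1; apply: m_max.1; apply: ideal1_setT. Qed.

Lemma ext_quot_1_neq0 : (1 : ext_quot m) <> 0.
Proof.
have -> : (1 : ext_quot m) = pi (val (1 : constants D)) by [].
by move/quot_pi_val_eq0; apply: max_ideal_not1.
Qed.

Variable J : ideal (ore E).

(** The constants that occur as be-th coefficients of such g form an ideal L containing m. Since f
    contributes a coefficient outside m, maximality puts 1 in L. *)
Lemma ore_ideal_normalize f be : J f -> (forall i al, E i (coef al f) = 0) ->
  coef be f <> 0 ->
  exists g, [/\ J g, forall i al, E i (coef al g) = 0,
    forall al, coef al f = 0 -> coef al g = 0 & coef be g = 1].
Proof.
move=> Jf Ef fbe.
pose L : set (constants D) := [set c | exists g,
  [/\ J g, forall i al, E i (coef al g) = 0,
    forall al, coef al f = 0 -> coef al g = 0 & coef be g = pi (val c)]].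
have L0 : L 0.
  exists 0; split; first exact: ideal0.
  - by move=> i al; rewrite ore_coef0 der0.
  - by move=> al _; rewrite ore_coef0.
  - by rewrite ore_coef0 (_ : val 0 = 0) ?quot_pi0.
have LD a b : L a -> L b -> L (a + b).
  move=> [g [Jg Eg fg ga]] [h [Jh Eh fh hb]]; exists (g + h); split.
  - exact: idealD.
  - by move=> i al; rewrite ore_coefD derD Eg Eh addr0.
  - by move=> al f0; rewrite ore_coefD fg // fh // addr0.
  - by rewrite ore_coefD ga hb -quot_piD.
have LMl a b : L b -> L (a * b).
  move=> [g [Jg Eg fg gb]]; exists (const (pi (val a)) * g); split.
  - exact: idealMl.
  - by move=> i al; rewrite ore_coef_constM derM Eg ext_quot_ders_val mul0r mulr0 addr0.
  - by move=> al f0; rewrite ore_coef_constM fg // mulr0.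
  - by rewrite ore_coef_constM gb -quot_piM.
(* A constant commutes with every t_j, so right multiplication by it acts on each coefficient
   separately. *)
have LMr a b : L a -> L (a * b).
  move=> [g [Jg Eg fg ga]]; exists (g * const (pi (val b))).
  have Eb i := ext_quot_ders_val i b; split.
  - exact: Defs.idealMr.
  - by move=> i al; rewrite ore_coefM_const // derM Eg Eb mul0r mulr0 addr0.
  - by move=> al f0; rewrite ore_coefM_const // fg // mul0r.
  - by rewrite ore_coefM_const // ga -quot_piM.
pose LI := Ideal L0 LD LMl LMr.
have mL : ideal_set m `<=` LI.
  move=> y my; have -> : y = 0 + y by rewrite add0r.
  exists 0; split; first exact: ideal0.
  - by move=> i al; rewrite ore_coef0 der0.
  - by move=> al _; rewrite ore_coef0.
  - by rewrite ore_coef0 add0r; apply/esym/quot_pi_val_eq0.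
have [b fb] := lift_const (Ef^~ be).
have Lb : LI b by exists f.
have [LM|LT] := m_max.2 LI mL.
  by case: fbe; rewrite fb; apply/quot_pi_val_eq0; rewrite -LM.
have : LI 1 by rewrite LT.
by case=> g [Jg Eg fg g1]; exists g.
Qed.

(* An element with fewest terms among the nonzero ones with constant
   coefficients, normalized to have a coefficient 1, commutes with the
   constants. *)
Lemma ore_ideal_central_coef f : J f -> f <> 0 ->
  exists g, [/\ J g, g <> 0 & forall al, exists2 z : constants D,
    center (quot_pi m z) & coef al g = pi (val z)].
Proof.
move=> /(ore_ideal_const_coef (ext_quot_nilp D_nilp (m := m))) /[apply] -[g [Jg g0 Eg]].
have [n] := ubnP #|` msupp g|; elim: n g Jg g0 Eg => // n IH g Jg g0 Eg ltn.
have [be gbe] := ore_neq0 g0.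
have [h [Jh Eh gh h1]] := ore_ideal_normalize Jg Eg gbe.
have h0 : h <> 0.
  by move=> h0; apply: ext_quot_1_neq0; rewrite -h1 h0 ore_coef0.
have hsupp (k : ore E) : (forall al, coef al g = 0 -> coef al k = 0) ->
    (msupp k `<=` msupp g)%fset.
  move=> gk; apply/fsubsetP => al; rewrite -!mcoeff_neq0; apply: contraNN.
  by move=> /eqP ?; apply/eqP/gk.
(* Either h commutes with all constants, and its coefficients are central, or some commutator is a
   nonzero element of J with fewer terms. *)
have [comm|] := pselect (forall c : constants D, lie (const (pi (val c))) h = 0).
  exists h; split=> // al; have [z hz] := lift_const (Eh^~ al).
  exists z => // u; have [c ->] := quot_pi_surj u.
  (* The commutation is known in A/(m) and descends because (m) meets the constants in m. *)
  apply/esym; rewrite -!quot_piM; apply/quot_pi_eq.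
  apply: ext_const; apply/quot_pi_eq0.
  have := ore_coef0 E al; rewrite -(comm c) ore_coefB ore_coef_constM.
  rewrite ore_coefM_const; last by move=> i; apply: ext_quot_ders_val.
  rewrite hz -!quot_piM => /subr0_eq Ecz.
  apply/quot_pi_eq0; rewrite rmorphB !rmorphM; exact/quot_pi_eq.
move=> /existsNP[c hc].
have Ec i := ext_quot_ders_val i c.
have coefk al : coef al (lie (const (pi (val c))) h) =
    pi (val c) * coef al h - coef al h * pi (val c).
  by rewrite ore_coefB ore_coef_constM ore_coefM_const.
apply: (IH (lie (const (pi (val c))) h)) => //.
- exact: ideal_lie.
- move=> i al; rewrite coefk derD derN !derM Eh Ec.
  by rewrite !(mul0r, mulr0) addr0 subrr.
apply: leq_trans (_ : #|` msupp g| <= n)%N; last by rewrite -ltnS.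
apply: fproper_ltn_card; rewrite fproperE hsupp /=; last first.
  by move=> al /gh hal; rewrite coefk hal mulr0 mul0r subrr.
(* The monomial be drops out: its coefficient in the commutator is [c, 1] = 0. *)
apply/fsubsetPn; exists be; rewrite -?mcoeff_neq0; first exact/eqP.
by apply/negPn/eqP; rewrite -/(coef be _) coefk h1 mulr1 mul1r subrr.
Qed.

Lemma center_mulrn (z : constants D) n :
  center (quot_pi m z) -> center (quot_pi m (z *+ n)).
Proof.
move=> Cz a; have -> : quot_pi m (z *+ n) = quot_pi m z *+ n.
  by elim: n => [|n IH]; rewrite ?mulr0n ?quot_pi0 // !mulrS quot_piD IH.
by rewrite mulrnAl Cz mulrnAr.
Qed.

(* Commutation with x_i acts on central coefficients as the derivative with
   respect to t_i, lowering the degree. *)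
Lemma ore_ideal_trivial f : J f -> f <> 0 -> J 1.
Proof.
move=> /ore_ideal_central_coef /[apply] -[g [Jg g0 Zg]].
have Eg (h : ore E) : (forall al, exists2 z : constants D,
    center (quot_pi m z) & coef al h = pi (val z)) ->
    forall i al, E i (coef al h) = 0.
  by move=> Zh i al; have [z _ ->] := Zh al; apply: ext_quot_ders_val.
have [n gn] := @ore_coef_bounded _ _ E (fun al n => mdeg al < n)%N g
  (fun al n p np an => leq_trans an np) (fun al => ex_intro _ (mdeg al).+1 (ltnSn (mdeg al))).
elim: n g Jg g0 Zg gn => [|n IH] g Jg g0 Zg gn.
  by have [al /gn] := ore_neq0 g0.
have [[al gal al1]|gconst] := pselect (exists2 al, coef al g <> 0 & al != mone).
  have [i ali] : exists i, al i != 0%N.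
    apply: contrapT => /forallNP al0; move: al1 => /negP; apply; apply/cmP => i.
    by rewrite cm1; apply/eqP/negPn/negP/al0.
  have Exi j : E j (pi (x i)) = (j == i)%:R.
    by rewrite ext_quot_dersE D_x; case: (j == i); rewrite ?quot_pi0.
  pose h := lie g (const (pi (x i))).
  have coefh be : coef be h = coef (mmul be (ucm i)) g *+ (be i).+1.
    rewrite ore_coefB ore_coef_constM (ore_coefM_coord _ _ Exi).
    (* Central coefficients commute with x_i modulo (m) by [x_Z], so only the derivative term
       survives. *)
    have [z /(x_Z i) [y my Ey] ->] := Zg be.
    suff -> : pi (x i) * pi (val z) = pi (val z) * pi (x i) by rewrite addrAC subrr add0r.
    rewrite -!quot_piM; apply/quot_pi_eq; rewrite -[_ - _]/(lie _ _) -Ey.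
    exact: ext_ideal_sub.
  have Dal : mmul (divcm al (ucm i)) (ucm i) = al by rewrite divcm_ucmK // lt0n.
  apply: (IH h).
  - by apply: idealB; [apply: Defs.idealMr | apply: idealMl].
  (* At al - e_i the coefficient is al_i times that of g at al, nonzero in characteristic zero. *)
  - move=> h0; have := coefh (divcm al (ucm i)).
    by rewrite h0 ore_coef0 Dal => /esym /(quot_mulrn_eq0 K_char0).
  - move=> be; rewrite coefh; have [z Cz ->] := Zg (mmul be (ucm i)).
    exists (z *+ (be i).+1); first exact: center_mulrn.
    elim: (be i).+1 => [|k IHk]; first by rewrite !mulr0n quot_pi0.
    by rewrite !mulrS IHk -quot_piD.
  - move=> be; rewrite coefh => hbe.
    have /gn : coef (mmul be (ucm i)) g <> 0.
      by move=> g1; apply: hbe; rewrite g1 mul0rn.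
    by rewrite mdegM mdegU addn1.
(* Only the constant term is left, and normalizing it to 1 gives 1 in J. *)
have gmon be : be != mone -> coef be g = 0.
  by move=> be1; apply: contrapT => gbe; apply: gconst; exists be.
have [be gbe] := ore_neq0 g0.
have be1 : be = mone.
  by apply/eqP/negPn/negP => /gmon.
have [h [Jh _ gh h1]] := ore_ideal_normalize Jg (Eg _ Zg) gbe.
suff <- : h = 1 by [].
apply: ore_coefP => al; rewrite -ore_const1 ore_coef_mon.
have [<-|al1] := eqVneq mone al; first by rewrite -be1 h1.
by rewrite gh // gmon // eq_sym.
Qed.

Lemma ore_1_neq0 : (1 : ore E) <> 0.
Proof.
move=> E10; apply: ext_quot_1_neq0; rewrite -(ore_coef0 E mone) -E10.
by rewrite -ore_const1 ore_coef_mon eqxx.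
Qed.

End Simplicity.

Theorem theorem6p1
  (K : fieldType) (K_char0 : [pchar K] =i pred0)
  (A : algType K) (s : nat)
  (delta : comm_ders A s)
  (delta_linear : forall i, scalable (delta i))
  (delta_nilp : forall i, locally_nilpotent (delta i))
  (x : 'I_s -> A)
  (delta_x : forall i j, delta i (x j) = (i == j)%:R)
  (m : ideal (constants delta))
  (m_max : maximal_ideal m)
  (x_m : forall i (y : constants delta), m y ->
    (val @` ideal_set m) (lie (x i) (val y)))
  (x_Z : forall i (z : constants delta), center (quot_pi m z) ->
    (val @` ideal_set m) (lie (x i) (val z))) :
  simple_ring (ore (ext_quot_ders m)).
Proof.
split=> [|J].
  exact: (ore_1_neq0 K_char0 delta_linear delta_nilp delta_x m_max x_m).
have [[f Jf f0]|J0] := pselect (exists2 f, J f & f <> 0); [right|left].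
  apply: ideal1_setT.
  exact: (ore_ideal_trivial K_char0 delta_linear delta_nilp delta_x m_max x_m x_Z Jf).
apply/seteqP; split=> [f Jf|_ ->]; last exact: ideal0.
by apply: contrapT => f0; apply: J0; exists f.
Qed.
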